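(* Let $d\ge 2$ be an integer and let $f:\mathbb{R}\to\mathbb{R}$ be a continuous nonnegative $1$-periodic function which has exactly one zero $s_0$ in $[0,1)$. Then the transfer operator $L:C(\mathbb{T})\to C(\mathbb{T})$, $(Lu)(t)=\frac1d\sum_{i=0}^{d-1} f\left(\frac{t+i}{d}\right)u\left(\frac{t+i}{d}\right)$, is a Krein operator unless $s_0=\frac12$ and $d=2$.
   Context: $\mathbb{T}=\mathbb{R}/\mathbb{Z}$ is identified with $[0,1]$ with $0$ and $1$ identified. $C(\mathbb{T})$ is the Banach space of continuous complex-valued functions on $\mathbb{T}$ with the maximum norm. A function $w\in C(\mathbb{T})$ is called a unit if $w(t)>0$ for all $t\in\mathbb{T}$. $L$ is called a Krein operator if, for every $u\in C(\mathbb{T})$ with $u(t)\ge 0$ for all $t\in\mathbb{T}$ and $u(t_0)>0$ for at least one $t_0\in\mathbb{T}$, there is $n\in\mathbb{N}$ (possibly depending on $u$) such that $L^n u$ is a unit. *)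

(* Defs.v *)
From HB Require Import structures.
From mathcomp Require Import all_boot all_order all_algebra.
From mathcomp Require Import generic_quotient.
From mathcomp Require Import all_classical all_reals all_analysis.
From mathcomp Require Import complex.
Import Order.TTheory GRing.Theory Num.Theory.
Import numFieldNormedType.Exports.

Set Implicit Arguments.
Unset Strict Implicit.
Unset Printing Implicit Defensive.

Local Open Scope ring_scope.
Local Open Scope quotient_scope.
Local Open Scope complex_scope.
Local Open Scope classical_set_scope.

Section Circle.
Variable R : realType.

Definition eq_mod1 (x y : R) : bool := x - y \is a Num.int.

Lemma eq_mod1_equiv : equiv_class_of eq_mod1.
Proof.
split => [x|x y|y x z]; rewrite /eq_mod1; first by rewrite subrr rpred0.
- by rewrite -opprB rpredN.
- by move=> xy yz; rewrite -(subrKA y) rpredD.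
Qed.

Canonical eq_mod1_equiv_rel := EquivRelPack eq_mod1_equiv.

(* T = R / Z, with the quotient topology. *)
Definition circle : Type := {eq_quot eq_mod1_equiv_rel}.
HB.instance Definition _ := Quotient.on circle.
HB.instance Definition _ := Topological.copy circle (quotient_topology circle).

End Circle.

(* R[i] as a numFieldType, so that it carries the topology of its norm.  Its
   order is such that 0 <= z (resp. 0 < z) means that z is real and
   nonnegative (resp. positive). *)
Definition Cplx (R : realType) : numFieldType := Num.NumField.clone R[i] _.

Definition C_circle (R : realType) : Type :=
  continuousType (circle R) (Cplx R).

Lemma real_complex_continuous (R : realType) :
  continuous (fun x : R => x%:C : Cplx R).
Proof.
move=> x; apply/cvgrPdist_lt => e e0.
have e0' : 0 < complex.Re e by move: e0; rewrite ltcE => /andP[].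
have -> : e = (complex.Re e)%:C.
  by move: e0; rewrite ltcE => /andP[/eqP /= ei _]; case: e ei {e0'} => a b /= ->.
near=> y; rewrite -rmorphB /= normc_def /= expr0n /= addr0 sqrtr_sqr ltcR.
near: y; exact: (@cvgr_dist_lt _ R _ _ _ id x).
Unshelve. all: by end_near. Qed.

Section Transfer.
Variables (R : realType) (d : nat) (f : R -> R).
Hypotheses (f_cont : continuous f) (f_per : periodic f 1).

(* The function L u read on R; it is 1-periodic, see transfer_lift_eq_mod. *)
Definition transfer_lift (u : C_circle R) (x : R) : Cplx R :=
  d%:R^-1 * \sum_(i < d) (f ((x + i%:R) / d%:R))%:C
                         * u (\pi_(circle R) ((x + i%:R) / d%:R)).

Lemma transfer_lift_continuous u : continuous (transfer_lift u).
Proof.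
have h_cont (i : nat) : continuous (fun x : R => (x + i%:R) / d%:R).
  by move=> x; apply: cvgM; [apply: cvgD; [exact: cvg_id|exact: cvg_cst]|exact: cvg_cst].
have g_cont (g : R -> Cplx R) (i : nat) : continuous g ->
    continuous (fun x : R => g ((x + i%:R) / d%:R)).
  move=> gc x; exact: (@continuous_comp _ _ (Cplx R)
    (fun x : R => (x + i%:R) / d%:R) g x (h_cont i x) (gc _)).
have fC_cont : continuous (fun x : R => (f x)%:C : Cplx R).
  move=> x; exact: (@continuous_comp _ _ (Cplx R) f
    (fun y : R => y%:C) x (@f_cont x) (@real_complex_continuous R (f x))).
have u_cont : continuous (fun x : R => u (\pi_(circle R) x)).
  apply/(quotient_continuous (u : circle R -> Cplx R)).
  exact: cts_fun.
move=> x; apply: cvgM; first exact: cvg_cst.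
apply: cvg_big => [|i _]; first exact: add_continuous.
by apply: cvgM; [exact: (g_cont _ _ fC_cont)|exact: (g_cont _ _ u_cont)].
Qed.

Lemma transfer_lift_periodic u : periodic (transfer_lift u) 1.
Proof.
move=> x; rewrite /transfer_lift; congr (_ * _).
case: d => [|n]; first by rewrite !big_ord0.
pose F (i : nat) := (f ((x + i%:R) / n.+1%:R))%:C
  * u (\pi_(circle R) ((x + i%:R) / n.+1%:R)).
transitivity (\sum_(i < n.+1) F i.+1).
  by apply: eq_bigr => i _; rewrite /F -addrA nat1r.
rewrite -[RHS]/(\sum_(i < n.+1) F i) big_ord_recr [RHS]big_ord_recl addrC.
congr (_ + _); rewrite /F addr0 mulrDl divff ?pnatr_eq0// f_per.
congr (_ * u _); apply/eqmodP => /=.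
by rewrite /eq_mod1 addrAC subrr add0r rpred1.
Qed.

Lemma transfer_lift_eq_mod u :
  {homo transfer_lift u : a b / \pi_(circle R) a == \pi_(circle R) b >-> a == b}.
Proof.
move=> a b /eqP/eqmodP/intrP[[] n abE]; apply/eqP.
- have -> : a = b + 1 *+ n by rewrite -(subrK b a) addrC abE.
  exact: periodicn (transfer_lift_periodic u) _ _.
- have -> : b = a + 1 *+ n.+1.
    by rewrite -(subrK a b) addrC -(opprB a b) abE NegzE mulrNz opprK.
  by rewrite (periodicn (transfer_lift_periodic u)).
Qed.

Definition transfer_fun (u : C_circle R) (t : circle R) : Cplx R :=
  transfer_lift u (repr t).

Lemma transfer_continuous u : continuous (transfer_fun u).
Proof.
exact: (repr_comp_continuous (@transfer_lift_continuous u)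
  (@transfer_lift_eq_mod u)).
Qed.

Definition transfer (u : C_circle R) : C_circle R :=
  mkcts (@transfer_continuous u).

Lemma transferE u (x : R) :
  transfer u (\pi_(circle R) x) = transfer_lift u x.
Proof. by apply/eqP; apply: transfer_lift_eq_mod; rewrite reprK. Qed.

End Transfer.
Arguments transfer {R} d {f} f_cont f_per u.

Definition is_unit (R : realType) (w : C_circle R) : Prop :=
  forall t : circle R, 0 < w t.

(* N = {1, 2, ...} here. *)
Definition Krein (R : realType) (L : C_circle R -> C_circle R) : Prop :=
  forall u : C_circle R,
    (forall t, 0 <= u t) -> (exists t0, 0 < u t0) ->
    exists n : nat, (0 < n)%N /\ is_unit (iter n L u).

(* Main.v *)
(* For [v >= 0], [L v] can only vanish at a point [t] all of whose [d] preimages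
   under the expanding map [t |-> d t] are either [s0] or zeros of [v].  A
   function [u >= 0] which is positive somewhere is positive on an interval;
   iterating [L], the interval is stretched until it covers the circle, and only
   finitely many zeros remain.  From then on the number [z] of zeros drops to at
   most [(z + 1) / d], hence to [0], unless it gets stuck at [z = 1] with
   [d = 2].  In that case the zero is first moved to [2 s0], and then persists
   only if [2 s0] is the antipode of [s0], that is if [s0 = 1/2]. *)
Require Import Defs.
From mathcomp Require Import all_boot all_order all_algebra.
From mathcomp Require Import all_classical all_reals all_analysis.
From mathcomp Require Import complex zify ring lra.
Import Order.TTheory GRing.Theory Num.Theory.
Import numFieldNormedType.Exports.

Local Open Scope ring_scope.
Local Open Scope classical_set_scope.

Lemma periodic1_int (R : realType) (f : R -> R) (x y : R) :
  periodic f 1 -> x - y \is a Num.int -> f x = f y.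
Proof.
move=> fper /intrP[[] n xyE].
- have -> : x = y + 1 *+ n by rewrite -(subrK y x) addrC xyE.
  exact: periodicn fper _ _.
- have -> : y = x + 1 *+ n.+1.
    by rewrite -(subrK x y) addrC -(opprB x y) xyE NegzE mulrNz opprK.
  by rewrite (periodicn fper).
Qed.

(** * The expanding map [t |-> d t] of the circle and its fibers *)

Section Expanding.
Variables (R : realType) (d : nat).
Hypothesis d_ge2 : (2 <= d)%N.

Local Notation "[ 'pt' x ]" := (\pi_(circle R)%qT x) (format "[ 'pt'  x ]").

Let d_neq0 : d%:R != 0 :> R. Proof. by rewrite pnatr_eq0; lia. Qed.

Lemma circle_eqP (x y : R) : reflect ([pt x] = [pt y]) (x - y \is a Num.int).
Proof. by apply: (iffP idP) => [h|/eqmodP//]; apply/eqmodP. Qed.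

Definition expand (t : circle R) : circle R := [pt d%:R * repr t].

Definition branch (t : circle R) (i : nat) : circle R :=
  [pt (repr t + i%:R) / d%:R].

Lemma expand_pi (x : R) : expand [pt x] = [pt d%:R * x].
Proof.
apply/circle_eqP; rewrite -mulrBr rpredM ?rpred_nat//.
by apply/circle_eqP; rewrite reprK.
Qed.

Lemma branchK (t : circle R) (i : nat) : expand (branch t i) = t.
Proof.
rewrite expand_pi mulrC divfK// -[RHS]reprK; apply/circle_eqP.
by rewrite addrAC subrr add0r rpred_nat.
Qed.

Lemma branch_inj (t : circle R) (i j : nat) :
  (i < d)%N -> (j < d)%N -> branch t i = branch t j -> i = j.
Proof.
move=> id jd /circle_eqP/intrP[m]; rewrite -mulrBl opprD addrACA subrr add0r.
move=> /(congr1 (fun x => x * d%:R)); rewrite divfK// => h.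
have : (Posz i - Posz j)%:~R = (m * d)%:~R :> R.
  by rewrite intrB intrM -!pmulrn.
move/intr_inj => {}h.
(* [i - j = m * d] with both indices below [d] forces [m = 0]. *)
have [m0|[m_ge1|m_leN1]] : m = 0 \/ (1 <= m)%R \/ (m <= -1)%R by lia.
- by move: h; rewrite m0; lia.
- by nia.
- by nia.
Qed.

(** Fibers over distinct points are disjoint and each has [d] distinct branches, all of which lie in
    [s]. *)
Lemma size_full_fibers (s s' : seq (circle R)) :
  uniq s' -> {in s', forall t, forall x, expand x = t -> x \in s} ->
  (d * size s' <= size s)%N.
Proof.
move=> us' fib.
have -> : (d * size s' = size [seq branch t i | t <- s', i <- iota 0 d])%N.
  by rewrite size_allpairs size_iota mulnC.
apply: uniq_leq_size.
  apply: allpairs_uniq => //; first exact: iota_uniq.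
  move=> _ _ /allpairsP[[t i] [/= _ + ->]] /allpairsP[[t' j] [/= _ + ->]].
  rewrite !mem_iota !add0n /= => id jd ij.
  have tt' : t = t' by rewrite -(branchK t i) ij branchK.
  by subst t'; congr pair; apply: branch_inj ij.
move=> _ /allpairsP[[t i] [/= ts' _ ->]].
exact: fib (branchK _ _).
Qed.

(** Branches 0 and 1 over [t] are distinct, so they are [a] and [b] in some order. *)
Lemma fiber_pair (a b t : circle R) :
  (forall x, expand x = t -> x \in [:: a; b]) ->
  [/\ expand a = t, expand b = t & a <> b].
Proof.
move=> fib.
have b01 : branch t 0 <> branch t 1 by move/branch_inj => /(_ _ _); lia.
move: (fib _ (branchK t 0)) (fib _ (branchK t 1)) b01.
move: (branchK t 0) (branchK t 1); rewrite !inE.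
move: (branch t 0) (branch t 1) => x y ? ? /orP[]/eqP ? /orP[]/eqP ? ?;
  by split; congruence.
Qed.

Lemma circle_itv (a b : R) (t : circle R) :
  1 < b - a -> exists2 x, a < x < b & t = [pt x].
Proof.
move=> ab; pose m := Num.floor (a - repr t).
(* The first integer translate of [repr t] beyond [a]: it is at most [a + 1], hence below [b]. *)
exists (repr t + (m + 1)%:~R).
  have := floor_le (a - repr t); have := floorD1_gt (a - repr t).
  rewrite -/m intrD; lra.
by rewrite -[LHS]reprK; apply/circle_eqP; rewrite opprD addNKr rpredN intr_int.
Qed.

End Expanding.
Arguments expand {R} d t.

Lemma continuous_pos_itv (R : realType) (u : C_circle R) (t0 : circle R) :
  (forall t, 0 <= u t) -> 0 < u t0 ->
  exists a b : R, a < b /\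
    forall x, a < x < b -> 0 < u (\pi_(circle R)%qT x).
Proof.
move=> u_ge0 u_gt0.
have uc : continuous (fun x : R => u (\pi_(circle R)%qT x) : Cplx R).
  apply/(quotient_continuous (u : circle R -> Cplx R)).
  exact: cts_fun.
(* The tolerance is [u t0] itself: a value 0 would lie at distance exactly [u t0]. *)
have /cvgrPdist_lt/(_ _ u_gt0) := uc (repr t0).
rewrite reprK => /nbhs_ballP[e /= e0 he].
exists (repr t0 - e), (repr t0 + e); split; first lra.
move=> x xe; have /he/= : ball (repr t0) e x.
  by rewrite /ball /= ltr_distlC; lra.
rewrite lt0r u_ge0 andbT; apply: contraTneq => ->.
by rewrite subr0 ger0_norm ?u_ge0// ltxx.
Qed.

(** * How [L] propagates positivity and reduces the number of zeros *)

Section Zeros.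
Variables (R : realType) (d : nat) (f : R -> R) (s0 : R).
Hypotheses (d_ge2 : (2 <= d)%N) (f_cont : continuous f).
Hypotheses (f_ge0 : forall x : R, 0 <= f x) (f_per : periodic f 1).
Hypothesis f_zero : unique (fun s : R => 0 <= s < 1 /\ f s = 0) s0.

Local Notation "[ 'pt' x ]" := (\pi_(circle R)%qT x) (format "[ 'pt'  x ]").
Local Notation L := (transfer d f_cont f_per).

Let d_neq0 : d%:R != 0 :> R. Proof. by rewrite pnatr_eq0; lia. Qed.
Let d_gt0 : 0 < d%:R :> R. Proof. by rewrite ltr0n; lia. Qed.

Lemma weight_gt0 (x : R) : [pt x] <> [pt s0] -> 0 < f x.
Proof.
move=> xs0; rewrite lt0r f_ge0 andbT; apply/eqP => fx0; apply: xs0.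
have xE : x - (x - (Num.floor x)%:~R) \is a Num.int.
  by rewrite subKr intr_int.
have [_ /(_ (x - (Num.floor x)%:~R)) ->] := f_zero; first exact/circle_eqP.
split; last by rewrite -(periodic1_int _ _ _ _ f_per xE).
have := floor_le x; have := floorD1_gt x; rewrite intrD; lra.
Qed.

Lemma transfer_term_ge0 (v : C_circle R) (x y : R) :
  (forall t, 0 <= v t) -> 0 <= (f x)%:C%C * v [pt y].
Proof. by move=> v_ge0; rewrite mulr_ge0// lecR. Qed.

Lemma transfer_ge0 (v : C_circle R) :
  (forall t, 0 <= v t) -> forall t, 0 <= L v t.
Proof.
move=> v_ge0 t; rewrite -[t]reprK transferE mulr_ge0 ?invr_ge0 ?ler0n//.
by apply: sumr_ge0 => i _; exact: transfer_term_ge0.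
Qed.

Lemma transfer_gt0 (v : C_circle R) (t : circle R) :
  (forall t, 0 <= v t) -> t <> [pt s0] -> 0 < v t -> 0 < L v (expand d t).
Proof.
move=> v_ge0 ts0 vt; rewrite transferE mulr_gt0 ?invr_gt0 ?ltr0n//; first lia.
have d0 : (0 < d)%N by lia.
(* At the representative [d * repr t], the term of index 0 is the one of the preimage [t]. *)
rewrite (bigD1 (Ordinal d0))//= addr0 mulrAC divff// mul1r reprK.
apply: ltr_wpDr; first by apply: sumr_ge0 => i _; exact: transfer_term_ge0.
by rewrite mulr_gt0// ltcR weight_gt0// reprK.
Qed.

Lemma iter_transfer_ge0 (v : C_circle R) (k : nat) :
  (forall t, 0 <= v t) -> forall t, 0 <= iter k L v t.
Proof. by move=> v_ge0; elim: k => //= k; exact: transfer_ge0. Qed.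

(** Each step stretches the interval by [d]; the exceptional points are the images of the previous
    ones and of [s0]. *)
Lemma iter_transfer_gt0_itv (v : C_circle R) (a b : R) (k : nat) :
  (forall t, 0 <= v t) -> (forall x, a < x < b -> 0 < v [pt x]) ->
  exists s : seq (circle R),
    forall x, d%:R ^+ k * a < x < d%:R ^+ k * b -> [pt x] \notin s ->
      0 < iter k L v [pt x].
Proof.
move=> v_ge0 v_gt0; elim: k => [|k [s IH]].
  by exists [::] => x; rewrite !mul1r => /v_gt0.
exists (map (expand d) ([pt s0] :: s)) => x xab xs.
have xE : [pt x] = expand d [pt x / d%:R].
  by rewrite expand_pi mulrC divfK.
have /norP[/eqP xs0 xns] : [pt x / d%:R] \notin [pt s0] :: s.
  by apply: contra xs => xs; rewrite xE map_f.
rewrite xE iterS; apply: transfer_gt0 => //; first exact: iter_transfer_ge0.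
apply: IH => //; move: xab.
by rewrite ltr_pdivlMr// ltr_pdivrMr// !exprSr -!mulrA ![_ * d%:R]mulrC.
Qed.

Lemma iter_transfer_finite_zeros (v : C_circle R) :
  (forall t, 0 <= v t) -> (exists t0, 0 < v t0) ->
  exists (k : nat) (s : seq (circle R)),
    forall t, t \notin s -> 0 < iter k L v t.
Proof.
move=> v_ge0 [t0 vt0].
have [a [b [ab v_gt0]]] := continuous_pos_itv _ _ _ v_ge0 vt0.
(* Then [d ^ k > k > 1 / (b - a)], so the stretched interval has length above 1 and covers the
   circle. *)
pose k := (Num.truncn (b - a)^-1).+1.
have [s hs] := iter_transfer_gt0_itv _ _ _ k v_ge0 v_gt0.
exists k, s => t.
have [|x xab ->] := circle_itv _ (d%:R ^+ k * a) (d%:R ^+ k * b) t.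
  rewrite -mulrBr -ltr_pdivrMr ?subr_gt0// mul1r.
  apply: (lt_trans (truncnS_gt _)).
  by rewrite -natrX ltr_nat ltn_expl.
exact: hs.
Qed.

(** By [transfer_gt0], a preimage outside [[pt s0] :: s] makes [L v] positive at its image. So zeros
    of [L v] have their whole fiber in that list, and counting fibers gives the bound. *)
Lemma transfer_zeros (v : C_circle R) (s : seq (circle R)) :
  (forall t, 0 <= v t) -> (forall t, t \notin s -> 0 < v t) ->
  exists s' : seq (circle R),
    [/\ forall t, t \notin s' -> 0 < L v t,
        {in s', forall t x, expand d x = t -> x \in [pt s0] :: s}
      & (d * size s' <= (size s).+1)%N].
Proof.
move=> v_ge0 v_gt0.
pose s' := [seq t <- undup (map (expand d) ([pt s0] :: s)) | ~~ (0 < L v t)].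
have pos x : x \notin [pt s0] :: s -> 0 < L v (expand d x).
  by move=> /norP[/eqP ? ?]; apply: transfer_gt0 => //; exact: v_gt0.
have fib : {in s', forall t x, expand d x = t -> x \in [pt s0] :: s}.
  move=> t + x xt; rewrite mem_filter -xt => /andP[/negP + _].
  by apply: contra_notT => /pos.
exists s'; split=> // [t|].
  rewrite mem_filter mem_undup; apply: contraNT => Lt; rewrite Lt andTb.
  (* Branch 0 is a preimage of [t], and it must lie in the list since [L v t] is not positive. *)
  rewrite -[X in X \in _](branchK _ _ d_ge2 t 0) map_f//.
  by apply: contraR Lt => /pos; rewrite branchK.
apply: (size_full_fibers _ _ d_ge2 _ _ _ fib).
by rewrite filter_uniq// undup_uniq.
Qed.

Lemma transfer_unit (v : C_circle R) : is_unit v -> is_unit (L v).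
Proof.
move=> v_gt0; have [|t _|s' [pos _]] := transfer_zeros v [::].
- by move=> t; exact/ltW/v_gt0.
- exact: v_gt0.
- by case: s' pos => [pos _ t|t s' _ /=]; [exact: pos|nia].
Qed.

(** * Elimination of the remaining zeros *)

Hypothesis s0_d : ~ (s0 = 2^-1 /\ d = 2%N).

(** [4 s0 = 2 s0] modulo 1 makes [2 s0] an integer in [[0, 2)]; the value 1 is excluded, so
    [s0 = 0]. *)
Lemma doubling_s0_fixed :
  d = 2%N -> expand d (expand d [pt s0]) = expand d [pt s0] ->
  [pt s0] = expand d [pt s0].
Proof.
move=> d2; rewrite !expand_pi => /circle_eqP/intrP[m hm].
have [[s0_itv _] _] := f_zero.
have s0E : 2 * s0 = m%:~R :> R by rewrite -hm d2; ring.
have m_ge0 : (0 <= m)%R by rewrite -(ler0z R) -s0E; lra.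
have m_lt2 : (m < 2)%R by rewrite -(ltr_int R) -s0E; lra.
have [m0|m1] : m = 0 \/ m = 1 by lia.
  have -> : s0 = 0 by move: s0E; rewrite m0; lra.
  by rewrite mulr0.
by case: s0_d; split=> //; move: s0E; rewrite m1; lra.
Qed.

(** A zero [t] surviving one step is the image of [s0]. If a zero [t'] survives a second step, its
    fiber is [s0] and [t], with [s0] different from [t]; then [t' = t] is fixed, which forces
    [s0 = t]. *)
Lemma iter_transfer_one_zero (v : C_circle R) (z : circle R) :
  d = 2%N -> (forall t, 0 <= v t) -> (forall t, t \notin [:: z] -> 0 < v t) ->
  exists k, is_unit (iter k L v).
Proof.
move=> d2 v_ge0 v_gt0.
have [[|t [|? ?]] [pos fib]] := transfer_zeros v _ v_ge0 v_gt0; last 1 first.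
- by rewrite /= d2; lia.
- by move=> _; exists 1%N => t; exact: pos.
move=> _; have [s0t _ _] := fiber_pair _ _ d_ge2 _ _ _ (fib t (mem_head _ _)).
have [[|t' [|? ?]] [pos' fib']] :=
    transfer_zeros (L v) _ (transfer_ge0 _ v_ge0) pos; last 1 first.
- by rewrite /= d2; lia.
- by move=> _; exists 2%N => t'; exact: pos'.
have [s0t' tt' s0_neq] :=
  fiber_pair _ _ d_ge2 _ _ _ (fib' t' (mem_head _ _)).
by move=> _; case: s0_neq; rewrite -s0t; apply: doubling_s0_fixed; congruence.
Qed.

Lemma iter_transfer_unit (n : nat) (v : C_circle R) (s : seq (circle R)) :
  (size s <= n)%N -> (forall t, 0 <= v t) ->
  (forall t, t \notin s -> 0 < v t) -> exists k, is_unit (iter k L v).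
Proof.
elim: n v s => [|n IH] v s sn v_ge0 v_gt0.
  by case: s sn v_gt0 => // _ v_gt0; exists 0%N => t; exact: v_gt0.
have [s' [pos _ s's]] := transfer_zeros _ _ v_ge0 v_gt0.
have [s'n|ns'] := leqP (size s') n.
  have [k kP] := IH _ _ s'n (transfer_ge0 _ v_ge0) pos.
  by exists k.+1; rewrite iterSr.
(* No drop in the bound means [d * (n + 1) <= n + 2], so [d = 2] and [n = 0]. *)
have d2 : d = 2%N by nia.
have : size s = 1%N by nia.
case: s v_gt0 {sn s's} => [|z []]// v_gt0 _.
exact: iter_transfer_one_zero v_gt0.
Qed.

End Zeros.

Theorem lemma2p4 (R : realType) (d : nat) (f : R -> R) (s0 : R)
    (d_ge2 : (2 <= d)%N)
    (f_cont : continuous f)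
    (f_ge0 : forall x : R, 0 <= f x)
    (f_per : periodic f 1)
    (f_zero : unique (fun s : R => 0 <= s < 1 /\ f s = 0) s0) :
  ~ (s0 = 2^-1 /\ d = 2%N) -> Krein (transfer d f_cont f_per).
Proof.
move=> s0_d u u_ge0 u_pos.
have [k [s s_zeros]] := iter_transfer_finite_zeros _ _ _ _ d_ge2 f_cont f_ge0
  f_per f_zero _ u_ge0 u_pos.
have [m m_unit] := iter_transfer_unit _ _ _ _ d_ge2 f_cont f_ge0 f_per f_zero
  s0_d _ _ _ (leqnn _)
  (iter_transfer_ge0 _ _ _ f_cont f_ge0 f_per _ k u_ge0) s_zeros.
(* One further application of [L] keeps the unit and makes the exponent positive. *)
exists (m + k).+1; split=> //; rewrite iterS iterD.
exact: transfer_unit d_ge2 f_cont f_ge0 f_per f_zero _ m_unit.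
Qed.
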